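(* (i) For all integers $n,d$ with $5\leq d\leq n-2$, we have $m(n,d)\geq \binom{n-d}{2}+n+2$. (ii) For every integer $n\geq 5$, we have $m(n,n-2)\geq n+3$.
   Context: Graphs are finite and simple; the order of a graph is its number of vertices and its size is its number of edges. An edge $e$ of a connected graph $G$ is a bridge if $G-e$ is disconnected. A graph is bridgeless if it is connected and contains no bridge. An orientation of a graph $G$ is a digraph obtained from $G$ by assigning to each edge $uv$ of $G$ exactly one of the directions $\overrightarrow{uv}$ or $\overrightarrow{vu}$. In a digraph, the distance from $u$ to $v$ is the minimum length (number of arcs) of a directed path from $u$ to $v$, and is $\infty$ if there is no such path. The diameter of a digraph is the maximum, over all ordered pairs $(u,v)$ of vertices, of the distance from $u$ to $v$. For given values $n$ and $d$, $m(n,d)$ denotes the minimum number (integer) $m$ such that every bridgeless graph of order $n$ and size at least $m$ has an orientation of diameter at most $d$ (with $m(n,d)=-\infty$ if every integer $m$ has this property). *)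

(* Defs.v *)
(* MathComp world, with the classical layer and extended numbers of
   MathComp-Analysis. *)
From HB Require Import structures.
From mathcomp Require Import all_boot all_order all_algebra.
From mathcomp Require Import boolp classical_sets constructive_ereal.

Set Implicit Arguments.
Unset Strict Implicit.
Unset Printing Implicit Defensive.
Import Order.TTheory GRing.Theory Num.Theory.

Record sgraph := SGraph {
  vertex :> finType;
  edge : rel vertex;
  edge_sym : symmetric edge;
  edge_irrefl : irreflexive edge }.

Definition gorder (G : sgraph) : nat := #|G|.

Definition edge_set (G : sgraph) : {set {set G}} :=
  [set [set p.1; p.2] | p : G * G & edge p.1 p.2].

Definition gsize (G : sgraph) : nat := #|edge_set G|.

Definition connected (T : finType) (e : rel T) : Prop :=
  forall x y : T, connect e x y.

(* Adjacency in G - xy. *)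
Definition delete_edge (G : sgraph) (x y : G) : rel G :=
  fun u v => edge u v && ([set u; v] != [set x; y]).

Definition bridge (G : sgraph) (x y : G) : Prop :=
  edge x y /\ ~ connected (delete_edge x y).

Definition bridgeless (G : sgraph) : Prop :=
  connected (@edge G) /\ forall x y : G, ~ bridge x y.

Definition orientation (G : sgraph) (D : rel G) : Prop :=
  (forall u v, D u v -> edge u v) /\
  (forall u v, edge u v -> D u v (+) D v u).

Section Digraph.
Variables (T : finType) (D : rel T).

Definition has_dipath (u v : T) (k : nat) : bool :=
  [exists p : k.-tuple T, [&& path D u p, last u p == v & uniq (u :: p)]].

Definition dist (u v : T) : \bar int :=
  if pselect (exists k, has_dipath u v k) is left h
  then (Posz (ex_minn h))%:E%E else +oo%E.

(* Distances are nonnegative, so 0 is neutral for the maximum. *)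
Definition diameter : \bar int :=
  \big[Order.max/0%E]_(p : T * T) dist p.1 p.2.

End Digraph.

Definition size_suffices (n d : nat) (m : int) : Prop :=
  forall G : sgraph, bridgeless G -> gorder G = n -> (m <= Posz (gsize G))%R ->
  exists D : rel G, orientation D /\ (diameter D <= (Posz d)%:E)%E.

Definition least_suffices (n d : nat) (m : int) : Prop :=
  size_suffices n d m /\ forall m', size_suffices n d m' -> (m <= m')%R.

(* The value m(n,d); by min_size_leastP below, xget never takes its default. *)
Definition min_size (n d : nat) : \bar int :=
  if `[< forall m, size_suffices n d m >] then -oo%E
  else (xget 0%R [set m | least_suffices n d m])%:E%E.

Lemma gsize_le (G : sgraph) : gsize G <= gorder G * gorder G.
Proof.
rewrite /gsize /edge_set /gorder -card_prod; apply: leq_trans (leq_imset_card _ _) _.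
exact: max_card.
Qed.

Lemma size_suffices_le n d (m m' : int) :
  (m <= m')%R -> size_suffices n d m -> size_suffices n d m'.
Proof. by move=> mm' sm G bG oG m'G; apply: sm => //; exact: le_trans m'G. Qed.

Lemma min_size_leastP n d : ~ (forall m, size_suffices n d m) ->
  exists2 m, min_size n d = m%:E%E & least_suffices n d m.
Proof.
move=> nall.
have n0 : ~ size_suffices n d 0.
  by move=> s0; apply: nall => m G bG oG _; apply: s0.
pose P k := `[< size_suffices n d (Posz k) >].
have exP : exists k, P k.
  exists (n * n).+1; apply/asboolP => G _ oG.
  by rewrite lez_nat leqNgt ltnS -oG gsize_le.
have [m ls] : exists m, least_suffices n d m.
  case: (ex_minnP exP) => k /asboolP sk kmin; exists (Posz k); split=> // m' sm'.
  case: m' sm' => k' sk'; first by rewrite lez_nat; apply: kmin; apply/asboolP.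
  by case: n0; apply: size_suffices_le sk'.
rewrite /min_size; case: asboolP => // _.
by exists (xget 0%R [set m | least_suffices n d m]) => //; exact: (xgetI _ ls).
Qed.

(* Main.v *)
(* For (i), join a cycle of length [d - 2], a triangle and a clique of order
   [n - d + 1] in a chain through two distinct cut vertices [a] and [b] of the
   triangle, [a] on the cycle and [b] in the clique. Reversing all arcs if
   necessary, the triangle has no arc from [a] to [b]. If the orientation is strong,
   then some vertex of the cycle has distance [d - 3] to [a], [a] has distance at
   least 2 to [b], and [b] has distance at least 2 to some vertex of the clique,
   which gives a distance of at least [d + 1]. All these bounds come from functions
   on the vertices that increase by at most 1 along each arc. For (ii), part (i)
   covers [n >= 7]; for [n = 5, 6], every orientation of a K4 with one edge
   subdivided once or twice is examined. *)
Require Import Defs.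
From mathcomp Require Import all_boot all_order all_algebra.
From mathcomp Require Import constructive_ereal.
From mathcomp Require Import boolp.
From mathcomp Require Import zify.

Set Implicit Arguments.
Unset Strict Implicit.
Unset Printing Implicit Defensive.

(** * Reduction to a single graph, and distances in digraphs *)

Lemma leq_count (T : eqType) (P : pred T) (s t : seq T) :
  uniq t -> (forall x, x \in t -> (x \in s) && P x) -> size t <= count P s.
Proof.
move=> tU tP; rewrite -size_filter; apply: uniq_leq_size => // x /tP.
by rewrite mem_filter andbC.
Qed.

(** [G] itself shows that the size [gsize G] does not suffice, so the minimum is attained and is at
    least [gsize G + 1]. *)
Lemma min_size_ge (n d m : nat) (G : sgraph) :
  bridgeless G -> gorder G = n -> m <= (gsize G).+1 ->
  (forall D : rel G, orientation D -> ~ (diameter D <= (Posz d)%:E)%E) ->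
  ((Posz m)%:E <= min_size n d)%E.
Proof.
move=> brG oG mG noD.
have nsuff : ~ size_suffices n d (Posz (gsize G)).
  by move=> /(_ G brG oG (Order.POrderTheory.lexx _)) [D [orD]]; exact: noD.
have [m0 -> [suff0 _]] : exists2 m0, min_size n d = m0%:E%E & least_suffices n d m0.
  by apply: min_size_leastP => /(_ (Posz (gsize G))).
rewrite lee_fin; have [|m0G] := Order.TotalTheory.leP (Posz m) m0 => //.
case: nsuff; apply: size_suffices_le suff0; lia.
Qed.

Lemma diameter_path (T : finType) (D : rel T) (d : nat) :
  (diameter D <= (Posz d)%:E)%E ->
  forall u v, exists2 p, path D u p & last u p = v /\ size p <= d.
Proof.
move=> diamD u v.
have : (dist D u v <= (Posz d)%:E)%E.
  apply: Order.POrderTheory.le_trans diamD.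
  exact: (Order.TotalTheory.le_bigmax _ (fun p => dist D p.1 p.2) (u, v)).
rewrite /dist; case: pselect => [h|_]; last by rewrite leye_eq.
case: ex_minnP => k /existsP[p /and3P[Dp /eqP lp _]] _.
by rewrite lee_fin lez_nat => kd; exists p => //; rewrite size_tuple.
Qed.

(** This bounds distances from below: a gap between the values of [f] at two vertices forces every
    path between them to be long. *)
Lemma potential_path (T : Type) (D : rel T) (f : T -> nat) :
  (forall x y, D x y -> f y <= (f x).+1) ->
  forall u p, path D u p -> f (last u p) <= f u + size p.
Proof.
move=> fD u p; elim: p u => [|v p IHp] u /=; first by rewrite addn0.
case/andP=> /fD fuv /IHp; lia.
Qed.

Lemma path_converse (T : eqType) (D : rel T) u p :
  path D u p ->
  exists2 q, path (fun x y => D y x) (last u p) q &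
    last (last u p) q = u /\ size q = size p.
Proof.
move=> Dp; exists (rev (belast u p)); first by rewrite rev_path.
rewrite size_rev size_belast; split=> //.
by case: p {Dp} => [|v p] //=; rewrite rev_cons last_rcons.
Qed.

(* Only the values [R x y] with [x < y] are used. *)
Definition sym_rel (R : rel nat) : rel nat :=
  fun x y => (x < y) && R x y || (y < x) && R y x.

(** * Graphs on an initial segment of the naturals *)

Section NatGraph.
Variables (n : nat) (R : rel nat).

Definition nat_edge : rel 'I_n := fun x y => sym_rel R x y.

Lemma nat_edge_sym : symmetric nat_edge.
Proof. by move=> x y; rewrite /nat_edge /sym_rel orbC. Qed.

Lemma nat_edge_irrefl : irreflexive nat_edge.
Proof. by move=> x; rewrite /nat_edge /sym_rel ltnn. Qed.

Definition nat_graph : sgraph := SGraph nat_edge_sym nat_edge_irrefl.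

(** Each edge is counted once, at its larger endpoint, since an ordered pair [x < y] is determined
    by the set of its two entries. *)
Lemma nat_graph_size :
  sumn [seq count (R^~ v) (iota 0 v) | v <- iota 0 n] <= gsize nat_graph.
Proof.
pose A := [set p : 'I_n * 'I_n | (p.1 < p.2) && R p.1 p.2].
have inj : {in A &, injective (fun p : 'I_n * 'I_n => [set p.1; p.2])}.
  move=> [x y] [z t]; rewrite !inE /= => /andP[xy _] /andP[zt _] e.
  have := set21 x y; have := set22 x y; rewrite e !inE.
  case/orP=> /eqP ey /orP[] /eqP ex; subst => //; first by rewrite ltnn in xy.
    by rewrite ltnNge ltnW in xy.
  by rewrite ltnn in xy.
have -> : sumn [seq count (R^~ v) (iota 0 v) | v <- iota 0 n] = #|A|.
  rewrite sumnE big_map -sum1_card.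
  rewrite (eq_bigl (fun p : 'I_n * 'I_n => true && ((p.1 < p.2) && R p.1 p.2))); last first.
    by move=> p; rewrite inE.
  rewrite -(pair_big_dep xpredT (fun x y : 'I_n => (x < y) && R x y) (fun _ _ => 1)) /=.
  rewrite (exchange_big_dep xpredT) //=.
  rewrite -[in LHS](subn0 n) -/(index_iota 0 n) big_mkord.
  apply: eq_bigr => v _.
  rewrite -sum1_count -[in iota 0 v](subn0 v) -/(index_iota 0 v) big_mkord.
  rewrite (big_ord_widen_cond n (R^~ v) (fun=> 1)); last exact: ltnW.
  by apply: eq_bigl => u; rewrite andbC.
rewrite -(card_in_imset inj); apply/subset_leq_card/fintype.subsetP => _ /imsetP[p Ap ->].
apply: imset_f; move: Ap; rewrite !inE /= /nat_edge /sym_rel.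
by move=> /= ->.
Qed.

Lemma delete_edgeE (x y u v : nat_graph) :
  delete_edge x y u v =
  nat_edge u v && ~~ ((u == x) && (v == y) || (u == y) && (v == x)).
Proof.
rewrite /delete_edge /=; case: (boolP (nat_edge u v)) => //= uv; congr (~~ _).
apply/eqP/idP => [e|]; last first.
  by case/orP=> /andP[/eqP-> /eqP->] //; rewrite setUC.
have uDv : u != v by apply: contraTneq uv => ->; rewrite nat_edge_irrefl.
have := set21 u v; have := set22 u v; rewrite e !inE.
by case/orP=> /eqP vE /orP[] /eqP uE; subst; rewrite ?eqxx ?orbT // eqxx in uDv *.
Qed.

Lemma delete_edge_sym (x y : nat_graph) : symmetric (delete_edge x y).
Proof.
move=> u v; rewrite !delete_edgeE nat_edge_sym; congr (_ && ~~ _).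
by rewrite orbC !(andbC (v == _)).
Qed.

(** A walk that uses the edge [xy] can be rerouted along the connection between [x] and [y] that
    survives its deletion. *)
Lemma bridgeless_nat_graph :
  connected nat_edge ->
  (forall x y : nat_graph, x < y -> R x y -> connect (delete_edge x y) x y) ->
  bridgeless nat_graph.
Proof.
move=> con del; split=> // x y [xy]; apply.
have {}del : connect (delete_edge x y) x y.
  have [/andP[lt_xy Rxy]|/andP[lt_yx Ryx]] := orP xy; first exact: del.
  rewrite (sym_connect_sym (delete_edge_sym x y)).
  rewrite (eq_connect (e' := delete_edge y x)); first exact: del.
  by move=> u v; rewrite /delete_edge [X in _ != X]setUC.
move=> u v; apply: connect_sub (con u v) => {}u {}v uv.
have [|] := boolP ((u == x) && (v == y) || (u == y) && (v == x)).
  case/orP=> /andP[/eqP-> /eqP->]; first exact: del.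
  by rewrite (sym_connect_sym (delete_edge_sym x y)).
by move=> Nuv; apply: connect1; rewrite delete_edgeE uv.
Qed.

End NatGraph.

(** * Computable reachability *)

Section Balls.
Implicit Type A : seq (nat * nat).

(** Breadth-first search on plain lists, so that the finite checks run under [vm_compute]. *)
Definition ball A (k x : nat) : seq nat :=
  iter k (fun s => undup (s ++ [seq p.2 | p <- A & p.1 \in s])) [:: x].

Lemma ballS A k x y :
  (y \in ball A k.+1 x) =
  (y \in ball A k x) || (y \in [seq p.2 | p <- A & p.1 \in ball A k x]).
Proof. by rewrite mem_undup mem_cat. Qed.

Lemma path_ball n A (D : rel 'I_n) k (u : 'I_n) p :
  (forall x y, D x y -> (val x, val y) \in A) -> path D u p -> size p <= k ->
  val (last u p) \in ball A k u.
Proof.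
move=> DA Dp; elim: k p Dp => [|k IHk] p; first by case: p => //=; rewrite inE.
rewrite ballS; case/lastP: p => [|p v]; first by move=> _ _; rewrite (IHk [::]).
rewrite rcons_path size_rcons last_rcons ltnS => /andP[Dp Dv] pk.
apply/orP; right; apply/mapP; exists (val (last u p), val v) => //.
by rewrite mem_filter DA // andbT; exact: IHk.
Qed.

Lemma ball_connect n A (e : rel 'I_n) k (x y : 'I_n) :
  {in A, forall p, p.2 < n} -> (forall u v : 'I_n, (val u, val v) \in A -> e u v) ->
  val y \in ball A k x -> connect e x y.
Proof.
move=> An Ae.
have ball_lt j z : z \in ball A j x -> z < n.
  elim: j => [|j IHj]; first by rewrite inE => /eqP->.
  by rewrite ballS => /orP[//|/mapP[p + ->]]; rewrite mem_filter => /andP[_ /An].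
elim: k y => [|k IHk] y; first by rewrite inE => /eqP/val_inj->.
rewrite ballS => /orP[/IHk//|/mapP[[z t]]]; rewrite mem_filter /= => /andP[zk zA] yt.
apply: connect_trans (IHk (Ordinal (ball_lt _ _ zk)) zk) (connect1 _).
by apply: Ae; rewrite /= yt.
Qed.

End Balls.

(** * Boolean checks of bridgelessness and of all orientations *)

Section FiniteCheck.
Variables (n : nat) (es : seq (nat * nat)).

Fixpoint all_bits k (P : seq bool -> bool) : bool :=
  if k is k'.+1 then
    all_bits k' (fun s => P (true :: s)) && all_bits k' (fun s => P (false :: s))
  else P [::].

Lemma all_bitsP k P : all_bits k P -> forall s, size s = k -> P s.
Proof.
elim: k P => [|k IHk] P /=; first by move=> ? [].
by case/andP=> Pt Pf [|[] s] //= [sk]; [apply: IHk Pt s sk|apply: IHk Pf s sk].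
Qed.

Definition listed : rel nat := fun x y => (x, y) \in es.

Definition both_arcs : seq (nat * nat) := es ++ [seq (p.2, p.1) | p <- es].

Definition bits_arcs (bs : seq bool) : seq (nat * nat) :=
  [seq if q.2 then q.1 else (q.1.2, q.1.1) | q <- zip es bs].

Definition full_ball A k x := all [in ball A k x] (iota 0 n).

Lemma bridgeless_check :
  [&& all (fun p => p.1 < p.2 < n) es, all (full_ball both_arcs n) (iota 0 n) &
    all (fun p => p.2 \in ball [seq q <- both_arcs | q \notin [:: p; (p.2, p.1)]] n p.1)
      es] ->
  bridgeless (nat_graph n listed).
Proof.
case/and3P=> /allP es_lt con del.
have arcs_lt : {in both_arcs, forall p, p.2 < n}.
  move=> p; rewrite mem_cat => /orP[/es_lt/andP[]//|/mapP[q /es_lt + ->]] /=.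
  by case/andP; exact: ltn_trans.
have arcsE (x y : 'I_n) : (val x, val y) \in both_arcs -> sym_rel listed x y.
  rewrite mem_cat /sym_rel /listed => /orP[xy|/mapP[[u v] uv [-> ->]]].
    by have /andP[/= -> _] := es_lt _ xy; rewrite xy.
  by have /andP[/= -> _] := es_lt _ uv; rewrite uv orbT.
apply: bridgeless_nat_graph => [x y|x y xy Rxy].
  apply: (ball_connect (k := n) arcs_lt) => //.
  by apply: (allP (allP con x _)); rewrite mem_iota ltn_ord.
apply: (ball_connect _ _ (allP del (val x, val y) Rxy)) => [p|u v].
  by rewrite mem_filter => /andP[_ /arcs_lt].
rewrite mem_filter !inE negb_or !xpair_eqE => /andP[/andP[uv vu] /arcsE uvE].
by rewrite delete_edgeE /nat_edge uvE negb_or uv vu.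
Qed.

Lemma orientation_check d :
  all_bits (size es) (fun bs => ~~ all (full_ball (bits_arcs bs) d) (iota 0 n)) ->
  forall D : rel (nat_graph n listed), orientation D ->
  ~ (diameter D <= (Posz d)%:E)%E.
Proof.
move=> chk D [Dedge Dxor] /diameter_path diam.
(* The bits of [es] that encode [D]; on pairs within range the default [false] is never reached. *)
pose b (p : nat * nat) : bool :=
  if (insub p.1, insub p.2) is (Some x, Some y) then D x y else false.
have bE (x y : 'I_n) : b (val x, val y) = D x y by rewrite /b /= !valK.
have /negP[] := all_bitsP chk (size_map b es).
have zipE : zip es (map b es) = [seq (p, b p) | p <- es].
  by elim: (es) => //= p s ->.
have DA (x y : 'I_n) : D x y -> (val x, val y) \in bits_arcs (map b es).
  move=> Dxy; have xy := Dedge _ _ Dxy; rewrite /bits_arcs zipE -map_comp.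
  have := Dxor _ _ xy; rewrite Dxy /= => /negbTE Dyx.
  have [/andP[_ Rxy]|/andP[_ Ryx]] := orP xy; apply/mapP.
    by exists (val x, val y); rewrite //= bE Dxy.
  by exists (val y, val x); rewrite //= bE Dyx.
apply/allP => x; rewrite mem_iota => /andP[_ xn].
apply/allP => y; rewrite mem_iota => /andP[_ yn].
have [p Dp [lp pd]] := diam (Ordinal xn) (Ordinal yn).
by have := path_ball DA Dp pd; rewrite lp.
Qed.

End FiniteCheck.

(** A K4 on 0, 1, 2, 3 whose edge between 2 and 3 is subdivided by 4. *)
Definition k4_subdivided : seq (nat * nat) :=
  [:: (0, 1); (0, 2); (0, 3); (1, 2); (1, 3); (2, 4); (3, 4)].

(** Here the edge between 2 and 3 becomes the path 2, 4, 5, 3. *)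
Definition k4_subdivided_twice : seq (nat * nat) :=
  [:: (0, 1); (0, 2); (0, 3); (1, 2); (1, 3); (2, 4); (3, 5); (4, 5)].

Lemma min_size_5_3 : ((Posz 8)%:E <= min_size 5 3)%E.
Proof.
apply: (@min_size_ge _ _ _ (nat_graph 5 (listed k4_subdivided))).
- by apply: bridgeless_check; vm_compute.
- exact: card_ord.
- by rewrite ltnS; apply: leq_trans (nat_graph_size _ _); vm_compute.
- by apply: orientation_check; vm_compute.
Qed.

Lemma min_size_6_4 : ((Posz 9)%:E <= min_size 6 4)%E.
Proof.
apply: (@min_size_ge _ _ _ (nat_graph 6 (listed k4_subdivided_twice))).
- by apply: bridgeless_check; vm_compute.
- exact: card_ord.
- by rewrite ltnS; apply: leq_trans (nat_graph_size _ _); vm_compute.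
- by apply: orientation_check; vm_compute.
Qed.

(** * The cycle, triangle and clique in a chain: size and bridgelessness *)

Section CycleTriangleClique.
Variables (a m : nat).
Hypotheses (a_ge2 : 2 <= a) (m_ge : a.+4 <= m).

(* The cycle is [0, ..., a], the triangle [a, a + 1, a + 2], and the clique
   [a + 2, ..., m]; the theorem uses [a = d - 3] and [m = n - 1]. *)
Definition chain : rel nat := fun i j =>
  [|| (j == i.+1) && (j <= a.+2), (i == 0) && (j == a),
      (i == a) && (j == a.+2) | a.+2 <= i].

Notation G := (nat_graph m.+1 chain).

Lemma chain_order : gorder G = m.+1. Proof. exact: card_ord. Qed.

(** Every [v > 0] is adjacent to [v - 1]. In addition [a] sees 0, which differs from [a - 1] as
    [a >= 2], then [a + 2] sees [a], and a later clique vertex sees [v - (a + 3)] further ones;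
    truncated subtraction gives 0 elsewhere. *)
Lemma chain_back_degree v :
  (0 < v) + (v == a) + (v == a.+2) + (v - a.+3) <= count (chain^~ v) (iota 0 v).
Proof.
have [va|v_neq_a] := eqVneq v a.
  apply: leq_trans (leq_count (t := [:: 0; a.-1]) _ _); first by rewrite /=; lia.
    by rewrite /= inE; lia.
  by move=> x; rewrite !inE mem_iota /chain; lia.
have [va2|v_neq_a2] := eqVneq v a.+2.
  apply: leq_trans (leq_count (t := [:: a; a.+1]) _ _); first by rewrite /=; lia.
    by rewrite /= inE; lia.
  by move=> x; rewrite !inE mem_iota /chain; lia.
have [va3|va3] := leqP v a.+3.
  have [->//|v0] := posnP v.
  apply: leq_trans (leq_count (t := [:: v.-1]) _ _); rewrite //=; first lia.
  by move=> x; rewrite !inE mem_iota /chain; lia.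
apply: leq_trans (leq_count (t := iota a.+2 (v - a.+2)) (iota_uniq _ _) _).
  by rewrite size_iota; lia.
by move=> x; rewrite !mem_iota /chain; lia.
Qed.

Lemma chain_size : 'C(m.+1 - a.+3, 2) + m.+1 + 1 <= gsize G.
Proof.
apply: leq_trans (nat_graph_size _ _); rewrite sumnE big_map.
pose B v := (0 < v) + (v == a) + (v == a.+2) + (v - a.+3).
apply: (@leq_trans (\sum_(v <- iota 0 m.+1) B v)); last first.
  by apply: leq_sum => v _; exact: chain_back_degree.
(* Stated for all prefixes to allow induction; the clique terms 0, 1, 2, ... add up to the binomial
   coefficient. *)
have sumE k :
    \sum_(0 <= v < k) B v = k.-1 + (a < k) + (a.+2 < k) + 'C(k - a.+3, 2).
  elim: k => [|k IHk]; first by rewrite big_nil.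
  rewrite big_nat_recr //= {}IHk /B.
  have -> : 'C(k.+1 - a.+3, 2) = 'C(k - a.+3, 2) + (k - a.+3).
    have [ak|ka] := leqP a.+3 k; first by rewrite subSn // binS bin1.
    by rewrite (_ : k.+1 - a.+3 = 0) 1?(_ : k - a.+3 = 0) //; lia.
  lia.
by have := sumE m.+1; rewrite /index_iota subn0 => ->; lia.
Qed.

Lemma range_connect (e : rel 'I_m.+1) i j : i <= j ->
  (forall k, i <= k < j -> e (inord k) (inord k.+1)) ->
  connect e (inord i) (inord j).
Proof.
elim: j => [|j IHj]; first by rewrite leqn0 => /eqP->.
rewrite leq_eqVlt ltnS => /predU1P[->//|ij] ek.
apply: connect_trans (IHj ij _) (connect1 (ek _ _)); last lia.
by move=> k kij; apply: ek; lia.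
Qed.

Lemma chain_delete_edge (x y i j : 'I_m.+1) :
  x < y -> i < j -> chain i j -> (i != x :> nat) || (j != y :> nat) ->
  @delete_edge G x y i j.
Proof.
move=> xy ij cij; rewrite delete_edgeE /nat_edge /sym_rel ij cij /=.
by rewrite -!val_eqE /=; lia.
Qed.

Lemma chain_bridgeless : bridgeless G.
Proof.
apply: bridgeless_nat_graph => [x y|x y].
  have con0 (z : 'I_m.+1) : connect (@nat_edge m.+1 chain) (inord 0) z.
    rewrite -[z]inord_val; apply: range_connect => // k kz.
    have := ltn_ord z => zm.
    by rewrite /nat_edge /sym_rel !inordK /chain; lia.
  apply: connect_trans (con0 y).
  by rewrite (sym_connect_sym (@nat_edge_sym _ _)).
have symD := sym_connect_sym (@delete_edge_sym m.+1 chain x y).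
have := ltn_ord x; have := ltn_ord y; move=> ym xm xy cxy.
(* An edge of a triangle is bypassed through the third vertex [w]. *)
have via w : w < m.+1 -> w != x -> w != y ->
    sym_rel chain x w -> sym_rel chain w y -> connect (@delete_edge G x y) x y.
  move=> wm wx wy xw wy'; apply: (@connect_trans _ _ (inord w)); apply: connect1;
  by rewrite delete_edgeE /nat_edge -!val_eqE /= inordK // ?xw ?wy' /=; lia.
(* Consecutive cycle vertices from [i] to [j] avoid [xy] if [xy] lies outside this range or is the
   closing edge from 0 to [a]. *)
have range i j : i <= j -> j <= a -> (j <= x) || (y <= i) || (x.+1 < y) ->
    connect (@delete_edge G x y) (inord i) (inord j).
  move=> ij ja out; apply: range_connect => // k kij.
  by apply: chain_delete_edge; rewrite ?inordK // /chain; lia.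
have [ya|ya] := leqP y a.
  have [yx1|yx1] := eqVneq (y : nat) x.+1; last first.
    rewrite -[X in connect _ X]inord_val -[X in connect _ _ X]inord_val.
    by apply: range; lia.
  rewrite -[X in connect _ X]inord_val -[X in connect _ _ X]inord_val.
  apply: (@connect_trans _ _ (inord 0)); first by rewrite symD; apply: range; lia.
  apply: (@connect_trans _ _ (inord a)); last by rewrite symD; apply: range; lia.
  apply: connect1; apply: chain_delete_edge; rewrite ?inordK // /chain; lia.
have [xa|xa] := leqP a.+2 x.
  (* The clique has at least three vertices since [a + 4 <= m]. *)
  have [w [wa wx wy]] : exists w, [/\ a.+2 <= w <= a.+4, w != x & w != y].
    have [|] := boolP ((a.+2 != x) && (a.+2 != y)); first by exists a.+2; split; lia.
    have [|] := boolP ((a.+3 != x) && (a.+3 != y)); first by exists a.+3; split; lia.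
    by exists a.+4; split; lia.
  by apply: (via w) => //; rewrite /sym_rel /chain; lia.
have [[xE yE]|[[xE yE]|[xE yE]]] : (x = a :> nat /\ y = a.+1 :> nat) \/
    (x = a.+1 :> nat /\ y = a.+2 :> nat) \/ (x = a :> nat /\ y = a.+2 :> nat).
  by move: cxy; rewrite /chain; lia.
- by apply: (via a.+2); rewrite ?xE ?yE /sym_rel /chain; lia.
- by apply: (via a); rewrite ?xE ?yE /sym_rel /chain; lia.
- by apply: (via a.+1); rewrite ?xE ?yE /sym_rel /chain; lia.
Qed.

(** * Potentials that force a large diameter *)

Section Diameter.
Variable D : rel G.
Hypothesis D_or : orientation D.

Lemma no_arc (i j : nat) (u v : G) :
  ~~ D (inord i) (inord j) -> D u v -> ~~ ((u == i :> nat) && (v == j :> nat)).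
Proof.
by move=> /negP Dij Duv; apply/negP => /andP[/eqP iE /eqP jE]; apply: Dij;
  rewrite -iE -jE !inord_val.
Qed.

Lemma converse_no_arc (x y : G) : D x y -> ~~ D y x.
Proof. by case: D_or => De Dx Dxy; have := Dx _ _ (De _ _ Dxy); rewrite Dxy. Qed.

(** If some set of vertices that no arc enters is at hand, [f] is [a + 4] on it and 0 elsewhere.
    Otherwise [f] measures progress from the cycle through the triangle into the clique, up to
    [a + 4]. *)
Lemma chain_potential :
  ~~ D (inord a) (inord a.+2) ->
  exists f : G -> nat, (forall x y, D x y -> f y <= (f x).+1) /\
    exists u v, f u + a.+3 < f v.
Proof.
move=> Dab.
have DR (x y : G) : D x y -> sym_rel chain x y by move/D_or.1.
have valK i : i <= m -> (inord i : 'I_m.+1) = i :> nat by move=> im; rewrite inordK.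
have [/existsP[v /andP[bv Dbv]]|Nv] :=
  boolP [exists v : G, (a.+2 < v) && ~~ D (inord a.+2) v]; last first.
  (* All clique arcs at [a + 2] point away from it, so no arc leads back to the vertices up to
     [a + 2]. *)
  exists (fun x : G => if x <= a.+2 then a.+4 else 0); split=> [x y Dxy|]; last first.
    by exists (inord a.+3), (inord 0); rewrite !valK ?ltnn ?leq0n; lia.
  case: ifP => // ya; case: ifP => // xa.
  have yE : y = inord a.+2.
    by apply/val_inj; rewrite /= valK; have := DR _ _ Dxy; rewrite /sym_rel /chain; lia.
  by case/negP: Nv; apply/existsP; exists x; rewrite -yE converse_no_arc // andbT; lia.
(* From [a] on, [top] grows by at most 1 along arcs: the arc from [a] to [a + 2] is absent, and [v],
   at height [a + 4], is no out-neighbour of [a + 2]. *)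
pose top (x : G) := if x <= a.+2 then x : nat else if D (inord a.+2) x then a.+3 else a.+4.
have topE (x : G) : x <= a.+2 -> top x = x by rewrite /top => ->.
have topv : top v = a.+4 by rewrite /top leqNgt bv (negbTE Dbv).
have top_ge (x : G) : a <= x -> a <= top x.
  by rewrite /top; case: ifP => //; case: ifP; lia.
have topD (x y : G) : a <= x -> D x y -> top y <= (top x).+1.
  move=> ax Dxy; have := DR _ _ Dxy; have := no_arc Dab Dxy.
  have : x = a.+2 :> nat -> D (inord a.+2) y by move=> <-; rewrite inord_val.
  rewrite /top /sym_rel /chain.
  by case: (D _ x); case: (D _ y); case: (leqP x a.+2); case: (leqP y a.+2); lia.
have [Da0|Da0] := boolP (D (inord 0) (inord a)); last first.
  (* Without the shortcut from 0 to [a], the cycle can only be climbed one vertex at a time, so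
     [top] works from 0. *)
  exists top; split=> [x y Dxy|]; last first.
    by exists (inord 0), v; rewrite topE valK // topv; lia.
  have [ax|xa] := leqP a x; first exact: topD.
  have := DR _ _ Dxy; have := no_arc Da0 Dxy; rewrite /sym_rel /chain => N0 R.
  by rewrite !topE; lia.
have [Da1|Da1] := boolP (D (inord a.-1) (inord a)).
  (* Both cycle arcs at [a] point into [a], so no arc enters the rest of the cycle. *)
  exists (fun x : G => if x < a then a.+4 else 0); split=> [x y Dxy|]; last first.
    by exists (inord a), (inord 0); rewrite !valK ?ltnn ?ifT; lia.
  have := DR _ _ Dxy; have := no_arc (converse_no_arc Da0) Dxy.
  have := no_arc (converse_no_arc Da1) Dxy.
  by rewrite /sym_rel /chain; case: (ltnP x a); case: (ltnP y a); lia.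
(* Now [a] is entered from the cycle only through 0, so the cycle is climbed downwards from [a - 1],
   which gets height 0, to 0, which gets [a - 1]. *)
exists (fun x : G => if x < a then a.-1 - x else top x); split=> [x y Dxy|]; last first.
  exists (inord a.-1), v; rewrite valK; last lia.
  rewrite ifT; last lia.
  by rewrite ifF ?topv; lia.
have := topD x y ^~ Dxy.
have := DR _ _ Dxy; have := no_arc Da1 Dxy; have := topE y; have := top_ge x.
by rewrite /sym_rel /chain; case: (ltnP x a); case: (ltnP y a); lia.
Qed.
End Diameter.

Lemma chain_diameter (D : rel G) :
  orientation D -> ~ (diameter D <= (Posz a.+3)%:E)%E.
Proof.
move=> D_or /diameter_path diam.
(* Applied to [D] and to its converse, this yields both arcs between [a] and [a + 2], which is
   absurd. *)
have noD (D' : rel G) : orientation D' ->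
    (forall u v, exists2 p, path D' u p & last u p = v /\ size p <= a.+3) ->
    D' (inord a) (inord a.+2).
  move=> D'_or short; apply/negPn/negP => /(chain_potential D'_or).
  case=> f [fD [u [v]]]; apply/negP; rewrite -leqNgt.
  have [p Dp [<- pa]] := short u v.
  by apply: leq_trans (potential_path fD Dp) _; rewrite leq_add2l.
have Dab := noD D D_or diam.
suff: D (inord a.+2) (inord a) by apply/negP; exact: converse_no_arc.
apply: (noD (fun x y => D y x)).
  case: D_or => Dedge Dxor; split=> u v; first by rewrite edge_sym; exact: Dedge.
  by rewrite addbC; exact: Dxor.
move=> u v; have [p /path_converse[q Dq [qu sq]] [pu pa]] := diam v u.
by rewrite pu in Dq qu; exists q; rewrite // sq.
Qed.
End CycleTriangleClique.

Theorem theorem3 :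
  (forall n d : nat, 5 <= d -> d <= n - 2 ->
     ((Posz ('C(n - d, 2) + n + 2)%N)%:E <= min_size n d)%E) /\
  (forall n : nat, 5 <= n ->
     ((Posz (n + 3)%N)%:E <= min_size n (n - 2))%E).
Proof.
have large n d : 5 <= d -> d <= n - 2 ->
    ((Posz ('C(n - d, 2) + n + 2)%N)%:E <= min_size n d)%E.
  case: n => [|n]; first lia.
  case: d => [|[|[|a]]] // a2 dn.
  have {}a2 : 2 <= a by lia.
  have an : a.+4 <= n by lia.
  apply: (min_size_ge (chain_bridgeless a2 an) (chain_order _ _)).
    by have := chain_size a2 an; lia.
  exact: chain_diameter.
(* For [n >= 7], the case [d = n - 2] of the first part has binomial coefficient 1. *)
split=> // n n5; have [n7|] := leqP 7 n.
  have := large n (n - 2) _ (leqnn _); rewrite subKn; last lia.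
  by rewrite binn (_ : 1 + n + 2 = n + 3); [apply|]; lia.
case: n n5 => [|[|[|[|[|[|[|n]]]]]]] // _ _; first exact: min_size_5_3.
exact: min_size_6_4.
Qed.
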